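(* For every integer $d\ge12$ there exists a $d$-dimensional integral polytope $\mathcal{P}$ such that the coefficients of $t^{d-2}$, $t^{d-3}$ and $t^{d-4}$ in $i(\mathcal{P},t)$ are positive and the coefficient of $t^{j}$ in $i(\mathcal{P},t)$ is negative for all $1\le j<d-4$.
   Context: An integral polytope is a convex polytope all of whose vertices have integer coordinates. For an integral polytope $\mathcal{P}\subseteq\mathbb{R}^N$ of dimension $d$, $i(\mathcal{P},t)=|t\mathcal{P}\cap\mathbb{Z}^N|$ ($t$ a positive integer) is a polynomial in $t$ of degree $d$, the Ehrhart polynomial. *)

(* Defs.v *)
From mathcomp Require Import all_boot all_order all_algebra finmap.
From mathcomp Require Import boolp classical_sets functions cardinality.
From mathcomp Require Import reals convex.

Set Implicit Arguments.
Unset Strict Implicit.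
Unset Printing Implicit Defensive.

Import Order.TTheory GRing.Theory Num.Theory.

Local Open Scope classical_set_scope.
Local Open Scope ring_scope.

Section Polytopes.
Context {R : realType} {N : nat}.
Implicit Types (A P S : set 'rV[R]_N) (x y : 'rV[R]_N).

Definition convex_hull S : set 'rV[R]_N := smallest (@convex_set R 'rV[R]_N) S.

Definition polytope P : Prop :=
  exists2 S, finite_set S & P = convex_hull S.

Definition dotrv x y : R := \sum_(i < N) x 0 i * y 0 i.

(* A vertex is a face of dimension 0: the set of points of P at which some
   linear functional attains its maximum over P is reduced to {x}. *)
Definition vertex P x : Prop :=
  P x /\ exists c, forall y, P y -> y != x -> dotrv c y < dotrv c x.

Definition lattice : set 'rV[R]_N :=
  [set x | forall i, x 0 i \is a Num.int].

Definition integral_polytope P : Prop :=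
  polytope P /\ vertex P `<=` lattice.

Definition affine_set A : Prop :=
  forall x y (t : R), A x -> A y -> A (t *: x + (1 - t) *: y).

Definition affine_hull P : set 'rV[R]_N := smallest affine_set P.

(* The affine hull of P is a translate of a linear subspace of dimension d;
   in particular P is nonempty. *)
Definition has_dim P (d : nat) : Prop :=
  exists (x : 'rV[R]_N) (U : {vspace 'rV[R]_N}),
    affine_hull P = [set x + u | u in [set` U]] /\ \dim U = d.

Definition dilate (t : nat) P : set 'rV[R]_N := [set t%:R *: x | x in P].

(* [fset_set] is only meaningful on finite sets; polytopes are bounded, so they
   have finitely many lattice points. *)
Definition ehrhart (P : set 'rV[R]_N) (t : nat) : nat :=
  #|` fset_set (dilate t P `&` lattice)|%fset.

(* At most one polynomial satisfies this, as it is prescribed at infinitely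
   many points. *)
Definition ehrhart_polynomial P (p : {poly R}) : Prop :=
  forall t : nat, (0 < t)%N -> p.[t%:R] = (ehrhart P t)%:R.

End Polytopes.

(* Main.v *)
(* Let T be the Reeve tetrahedron with vertices 0, e1, e2, e1 + e2 + m e3, and
   let P be the product of 4T with the cube [0, l]^n, where n = d - 3.  Above a
   lattice point (x, y) of the square [0, s]^2, the dilate sT contains
   m (min(x, y) - max(0, x + y - s)) + 1 lattice points, so that
     i(P, t) = (l t + 1)^n (m/6 ((4t)^3 - 4t) + (4t + 1)^2).
   For large m the sign of the coefficient of t^j is that of
   16 C(n, j-3) l^(j-3) - C(n, j-1) l^(j-1) whenever this is nonzero.  Putting
   k = j - 3, this compares 16 (k+1)(k+2) with l^2 (n-k)(n-k-1), and for
   l = n - 3 the sign changes exactly between j = n - 2 and j = n - 1.  The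
   factor 4 makes the ratio l/4 of the two dilations fall in the required range
   (n-3)(n-4)/20 < (l/4)^2 < (n-2)(n-3)/12. *)
From HB Require Import structures.
Require Import Defs.
From mathcomp Require Import all_boot all_order all_algebra finmap.
From mathcomp Require Import boolp classical_sets cardinality.
From mathcomp Require Import reals convex interval_inference.
From mathcomp Require Import ring lra zify.

Set Implicit Arguments.
Unset Strict Implicit.
Unset Printing Implicit Defensive.

Import Order.TTheory GRing.Theory Num.Theory.
Local Open Scope classical_set_scope.
Local Open Scope ring_scope.

(** * Convex sets, convex hulls and affine sets *)

Lemma convex_setP (R : realType) (V : lmodType R) (A : set V) :
  @convex_set R V A <->
  forall x y t, 0 <= t <= 1 -> A x -> A y -> A (t *: x + (1 - t) *: y).
Proof.
split=> [cA x y t t01 Ax Ay|cA x y t].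
  have [t0 t1] := andP t01.
  have := cA x y (Itv01 t0 t1); rewrite !inE => /(_ Ax Ay).
  by [].
rewrite !inE => Ax Ay; apply: cA => //.
by rewrite ge0 le1.
Qed.

Lemma convex_sum (R : realType) (V : lmodType R) (A : set V) (I : finType)
    (c : I -> R) (v : I -> V) :
  @convex_set R V A -> (forall i, 0 <= c i) -> \sum_i c i = 1 ->
  (forall i, A (v i)) -> A (\sum_i c i *: v i).
Proof.
move=> /convex_setP cA c0 c1 Av.
(* [C t w] says that [w] is [t] times a point of [A], with [w = 0] when [t = 0]. This invariant is
   stable under addition of pairs, so partial sums need no normalisation. *)
pose C (t : R) (w : V) := 0 <= t /\ (0 < t -> A (t^-1 *: w)) /\ (t = 0 -> w = 0).
suff: C (\sum_i c i) (\sum_i c i *: v i).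
  by rewrite c1 => -[_ [/(_ ltr01)]]; rewrite invr1 scale1r.
apply: (big_ind2 C).
- by split=> //; split=> //; rewrite ltxx.
- move=> s u t w [s0 [su su0]] [t0 [tw tw0]]; split; first exact: addr_ge0.
  split=> [st|st]; last first.
    have s00 : s = 0 by lra.
    have t00 : t = 0 by lra.
    by rewrite su0 // tw0 // addr0.
  have [s00|sn0] := eqVneq s 0.
    by move: st; rewrite s00 su0 // !add0r.
  have [t00|tn0] := eqVneq t 0.
    by move: st; rewrite t00 tw0 // !addr0.
  have sp : 0 < s by lra.
  have tp : 0 < t by lra.
  have -> : (s + t)^-1 *: (u + w) =
      (s / (s + t)) *: (s^-1 *: u) + (1 - s / (s + t)) *: (t^-1 *: w).
    rewrite scalerDr !scalerA; congr (_ *: _ + _ *: _); field; lra.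
  apply: cA; [|exact: su|exact: tw].
  by rewrite divr_ge0 ?ler_pdivrMr //; lra.
- move=> i _; split=> //; split=> [ci|->]; last by rewrite scale0r.
  by rewrite scalerA mulVf ?scale1r // gt_eqF.
Qed.

Section Hulls.
Context {R : realType} {N : nat}.
Implicit Types (S P A K : set 'rV[R]_N).

Lemma convex_hullP S P :
  convex_set P -> S `<=` P -> (forall K, convex_set K -> S `<=` K -> P `<=` K) ->
  convex_hull S = P.
Proof.
move=> cP SP min; apply/seteqP; split=> [|x Px K [cK SK]].
  exact: smallest_sub.
exact: (min K cK SK).
Qed.

Lemma dotrvDZ (c x y : 'rV[R]_N) (s t : R) :
  dotrv c (s *: x + t *: y) = s * dotrv c x + t * dotrv c y.
Proof.
rewrite /dotrv !mulr_sumr -big_split /=; apply: eq_bigr => i _.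
by rewrite !mxE; ring.
Qed.

(** If [x] were outside [S], then [S] would lie in the open half-space where the functional exposing
    [x] is below its value at [x]. That half-space is convex, so it would contain the hull and hence
    [x]. *)
Lemma vertex_convex_hull S : vertex (convex_hull S) `<=` S.
Proof.
move=> x [Sx [c cmax]]; apply: contrapT => nSx.
suff : dotrv c x < dotrv c x by rewrite ltxx.
apply: (smallest_sub (X := [set y | dotrv c y < dotrv c x])) Sx.
  apply/convex_setP => y z t t01 /= cy cz.
  have {t01}[t0 t1] := andP t01; rewrite dotrvDZ.
  by have [->|t0'] := eqVneq t 0; [lra|nra].
move=> y Sy; apply: cmax; first exact: sub_gen_smallest.
by apply: contra_notN nSx => /eqP <-.
Qed.

(** Since [A] contains 0 it is stable under scaling, and the combination is the midpoint of
    [(2 * s) *: u] and [(2 * t) *: v]. *)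
Lemma affine_set_add A u v (s t : R) :
  affine_set A -> A 0 -> A u -> A v -> A (s *: u + t *: v).
Proof.
move=> aA A0.
have AZ w r : A w -> A (r *: w).
  by move=> /(aA w 0 r) /(_ A0); rewrite scaler0 addr0.
move=> /(AZ u (2 * s)) Au /(AZ v (2 * t)) Av.
have := aA _ _ (2^-1) Au Av.
rewrite !scalerA; congr (A (_ *: _ + _ *: _)); lra.
Qed.

End Hulls.

(** * The prism over the Reeve tetrahedron as an integral polytope *)

Lemma sum_bool_pair (V : nmodType) (F : bool * bool -> V) :
  \sum_pq F pq = F (true, true) + F (true, false) + (F (false, true) + F (false, false)).
Proof.
rewrite (eq_bigr (fun pq => F (pq.1, pq.2))) => [|[] //].
by rewrite -(pair_bigA _ (fun p q => F (p, q))) /= !big_bool.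
Qed.

Section ReevePrism.
Context {R : realType} {n : nat}.
Implicit Types (x y z a b m : R) (w : 'rV[R]_n) (v : 'rV[R]_(3 + n)).

Definition prism_point x y z w : 'rV[R]_(3 + n) :=
  row_mx (\row_(i < 3) [:: x; y; z]`_i) w.

Definition xcoord v : R := v 0 (lshift n (0 : 'I_3)).
Definition ycoord v : R := v 0 (lshift n (1 : 'I_3)).
Definition zcoord v : R := v 0 (lshift n (ord_max : 'I_3)).
Definition wcoord v : 'rV[R]_n := rsubmx v.

Lemma xcoord_prism_point x y z w : xcoord (prism_point x y z w) = x.
Proof. by rewrite /xcoord row_mxEl mxE. Qed.

Lemma ycoord_prism_point x y z w : ycoord (prism_point x y z w) = y.
Proof. by rewrite /ycoord row_mxEl mxE. Qed.

Lemma zcoord_prism_point x y z w : zcoord (prism_point x y z w) = z.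
Proof. by rewrite /zcoord row_mxEl mxE. Qed.

Lemma wcoord_prism_point x y z w : wcoord (prism_point x y z w) = w.
Proof. exact: row_mxKr. Qed.

Definition coord_prism_point :=
  (xcoord_prism_point, ycoord_prism_point,
   zcoord_prism_point, wcoord_prism_point).

Lemma prism_point_coord v : prism_point (xcoord v) (ycoord v) (zcoord v) (wcoord v) = v.
Proof.
rewrite -[RHS]hsubmxK; congr row_mx; apply/rowP => -[[|[|[|//]]] i3];
  by rewrite !mxE /=; congr (v 0 (lshift n _)); apply: val_inj.
Qed.

Lemma xcoord_is_linear : linear (xcoord : 'rV[R]_(3 + n) -> R^o).
Proof. by move=> c u v; rewrite /xcoord !mxE. Qed.
Lemma ycoord_is_linear : linear (ycoord : 'rV[R]_(3 + n) -> R^o).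
Proof. by move=> c u v; rewrite /ycoord !mxE. Qed.
Lemma zcoord_is_linear : linear (zcoord : 'rV[R]_(3 + n) -> R^o).
Proof. by move=> c u v; rewrite /zcoord !mxE. Qed.
HB.instance Definition _ := GRing.isLinear.Build R _ R^o _ xcoord xcoord_is_linear.
HB.instance Definition _ := GRing.isLinear.Build R _ R^o _ ycoord ycoord_is_linear.
HB.instance Definition _ := GRing.isLinear.Build R _ R^o _ zcoord zcoord_is_linear.
HB.instance Definition _ := GRing.Linear.copy wcoord (@rsubmx R 1 3 n).

Lemma coord_inj u v : xcoord u = xcoord v -> ycoord u = ycoord v ->
  zcoord u = zcoord v -> wcoord u = wcoord v -> u = v.
Proof.
by move=> ex ey ez ew; rewrite -[u]prism_point_coord ex ey ez ew prism_point_coord.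
Qed.

(* [a] times the Reeve tetrahedron of parameter [m], times the cube [0, b]^n;
   the last inequality on [x, y, z] is [m (x + y - a) <= z]. *)
Definition reeve_prism m a b : set 'rV[R]_(3 + n) :=
  [set v | [/\ 0 <= zcoord v, zcoord v <= m * xcoord v, zcoord v <= m * ycoord v,
    m * (xcoord v + ycoord v) <= zcoord v + m * a &
    forall j, 0 <= wcoord v 0 j <= b]].

(** The four vertices of the tetrahedron are indexed by their projections to the corners of the
    square [[0, a]^2]; only the corner [(a, a)] is lifted, to height [m * a]. The function [g]
    selects a vertex of the cube. *)
Definition prism_vertex m a b (pqg : bool * bool * {ffun 'I_n -> bool}) :=
  let: (p, q, g) := pqg in
  prism_point (a *+ p) (a *+ q) ((m * a) *+ (p && q)) (\row_j (b *+ g j)).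

Lemma prism_vertex_reeve_prism m a b pqg :
  0 <= m -> 0 <= a -> 0 <= b -> reeve_prism m a b (prism_vertex m a b pqg).
Proof.
case: pqg => -[p q] g m0 a0 b0; have ma0 : 0 <= m * a by exact: mulr_ge0.
rewrite /reeve_prism /= !coord_prism_point; split.
- by case: p q => -[]; rewrite /= ?mulr1n ?mulr0n; lra.
- by case: p q => -[]; rewrite /= ?mulr1n ?mulr0n; lra.
- by case: p q => -[]; rewrite /= ?mulr1n ?mulr0n; lra.
- by case: p q => -[]; rewrite /= ?mulr1n ?mulr0n; lra.
- by move=> j; rewrite mxE; case: (g j); rewrite /= ?mulr1n ?mulr0n ?lexx ?b0.
Qed.

Lemma convex_reeve_prism m a b : convex_set (reeve_prism m a b).
Proof.
apply/convex_setP => u v t /andP[t0 t1] [u1 u2 u3 u4 u5] [v1 v2 v3 v4 v5].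
have t1' : 0 <= 1 - t by lra.
have mix (p q p' q' : R) : p <= q -> p' <= q' ->
    t * p + (1 - t) * p' <= t * q + (1 - t) * q'.
  by move=> pq pq'; apply: lerD; exact: ler_wpM2l.
rewrite /reeve_prism /= !linearD !linearZ /=.
split.
- by have := mix _ _ _ _ u1 v1; rewrite /GRing.scale /=; lra.
- by have := mix _ _ _ _ u2 v2; rewrite /GRing.scale /=; lra.
- by have := mix _ _ _ _ u3 v3; rewrite /GRing.scale /=; lra.
- by have := mix _ _ _ _ u4 v4; rewrite /GRing.scale /=; lra.
- move=> j; have /andP[u6 u7] := u5 j; have /andP[v6 v7] := v5 j.
  have := mix _ _ _ _ u6 v6; have := mix _ _ _ _ u7 v7.
  by rewrite /wcoord !mxE => *; apply/andP; split; lra.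
Qed.

Lemma sum_bool_ffun (h : 'I_n -> bool -> R) :
  \sum_(g : {ffun 'I_n -> bool}) \prod_i h i (g i) =
  \prod_i (h i true + h i false).
Proof.
rewrite -(bigA_distr_bigA h); apply: eq_bigr => i _.
by rewrite big_bool.
Qed.

(** Barycentres are taken in two stages: over the cube, with a tetrahedron vertex held fixed, to
    reach [w]; then over the four tetrahedron vertices, with [w] held fixed. *)
Lemma reeve_prism_sub_convex m a b (K : set 'rV[R]_(3 + n)) :
  0 < m -> 0 < a -> 0 < b -> convex_set K ->
  (forall pqg, K (prism_vertex m a b pqg)) -> reeve_prism m a b `<=` K.
Proof.
move=> m0 a0 b0 cK Kv v [].
set x := xcoord v; set y := ycoord v; set z := zcoord v; set w := wcoord v.
move=> z0 zx zy zxy wb.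
have ma0 : 0 < m * a by exact: mulr_gt0.
(* product weights exhibit [w] as a barycentre of the vertices of the cube *)
pose h (i : 'I_n) (e : bool) := if e then w 0 i / b else 1 - w 0 i / b.
have h0 i e : 0 <= h i e.
  have /andP[w0 wb1] := wb i.
  rewrite /h; case: e; first by rewrite divr_ge0 // ltW.
  by rewrite subr_ge0 ler_pdivrMr // mul1r.
pose mu (g : {ffun 'I_n -> bool}) := \prod_i h i (g i).
have mu1 : \sum_g mu g = 1.
  by rewrite sum_bool_ffun big1 // => i _; rewrite /h addrC subrK.
have muw j : \sum_g mu g * (b *+ g j) = w 0 j.
  (* Absorbing [b *+ g j] into the factor of index [j] makes the sum factor again; every other
     factor then sums to 1. *)
  have -> : \sum_g mu g * (b *+ g j) =
      \sum_(g : {ffun 'I_n -> bool})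
        \prod_i (h i (g i) * (if i == j then b *+ g i else 1)).
    apply: eq_bigr => g _; rewrite big_split /=; congr (_ * _).
    by rewrite -big_mkcond /= big_pred1_eq.
  rewrite (sum_bool_ffun (fun i e => h i e * (if i == j then b *+ e else 1))).
  rewrite (bigD1 j) //= eqxx big1 => [|i /negbTE ->]; last first.
    by rewrite !mulr1 /h addrC subrK.
  by rewrite mulr0n mulr0 addr0 mulr1 mulr1n /h divfK // gt_eqF.
have Kpq (p q : bool) : K (prism_point (a *+ p) (a *+ q) ((m * a) *+ (p && q)) w).
  have -> : prism_point (a *+ p) (a *+ q) ((m * a) *+ (p && q)) w =
      \sum_g mu g *: prism_vertex m a b (p, q, g).
    apply: coord_inj; rewrite linear_sum ?coord_prism_point.
    - under eq_bigr => g _ do rewrite linearZ /= coord_prism_point /GRing.scale /=.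
      by rewrite -mulr_suml mu1 mul1r.
    - under eq_bigr => g _ do rewrite linearZ /= coord_prism_point /GRing.scale /=.
      by rewrite -mulr_suml mu1 mul1r.
    - under eq_bigr => g _ do rewrite linearZ /= coord_prism_point /GRing.scale /=.
      by rewrite -mulr_suml mu1 mul1r.
    - apply/rowP => j; rewrite summxE -[LHS]muw; apply: eq_bigr => g _.
      by rewrite linearZ /= wcoord_prism_point !mxE.
  by apply: convex_sum => // g; exact: prodr_ge0.
(* The barycentric coordinates of [(x, y, z)] in the tetrahedron. Up to the factor [m * a], their
   nonnegativity is exactly the four facet inequalities. *)
pose lam (pq : bool * bool) : R :=
  match pq with
  | (true, true) => z / (m * a)
  | (true, false) => (m * x - z) / (m * a)
  | (false, true) => (m * y - z) / (m * a)
  | (false, false) => (z + m * a - m * (x + y)) / (m * a)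
  end.
have -> : v =
    \sum_pq lam pq *:
      prism_point (a *+ pq.1) (a *+ pq.2) ((m * a) *+ (pq.1 && pq.2)) w.
  have mn0 : m != 0 by rewrite gt_eqF.
  have an0 : a != 0 by rewrite gt_eqF.
  rewrite sum_bool_pair /= !mulr1n !mulr0n.
  apply: coord_inj; rewrite !linearD !linearZ /= !coord_prism_point -/x -/y -/z -/w.
  - by rewrite /GRing.scale /=; field; apply/andP.
  - by rewrite /GRing.scale /=; field; apply/andP.
  - by rewrite /GRing.scale /=; field; apply/andP.
  - by rewrite -!scalerDl -[LHS]scale1r; congr (_ *: _); field; apply/andP.
apply: convex_sum => //; last first.
  have mn0 : m != 0 by rewrite gt_eqF.
  have an0 : a != 0 by rewrite gt_eqF.
  by rewrite sum_bool_pair /=; field; apply/andP.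
by move=> [[] []] /=; apply: divr_ge0; solve [exact: ltW | lra].
Qed.

Lemma reeve_prism_hull m a b : 0 < m -> 0 < a -> 0 < b ->
  reeve_prism m a b = convex_hull (range (prism_vertex m a b)).
Proof.
move=> m0 a0 b0; rewrite (@convex_hullP _ _ _ (reeve_prism m a b)) //.
- exact: convex_reeve_prism.
- by move=> _ [pqg _ <-]; apply: prism_vertex_reeve_prism; exact: ltW.
- move=> K cK SK; apply: reeve_prism_sub_convex => // pqg.
  by apply: SK; exists pqg.
Qed.

Lemma integral_polytope_reeve_prism (m a b : nat) :
  (0 < m)%N -> (0 < a)%N -> (0 < b)%N ->
  integral_polytope (reeve_prism m%:R a%:R b%:R).
Proof.
move=> m0 a0 b0.
have hull := @reeve_prism_hull m%:R a%:R b%:R.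
rewrite !ltr0n in hull; have {}hull := hull m0 a0 b0.
split; first by exists (range (prism_vertex m%:R a%:R b%:R)); [exact: finite_image|].
rewrite hull => v /vertex_convex_hull[[[p q] g] _ <-] i.
rewrite /= mxE; case: (fintype.split i) => [k|k]; rewrite mxE; last first.
  by rewrite -mulrnA; apply: intr_nat.
by case: k => -[|[|[|//]]] ? /=; rewrite -?natrM -mulrnA; apply: intr_nat.
Qed.

(** An affine set containing the prism contains 0, so it is a linear subspace; it also contains the
    three other tetrahedron vertices and the multiples [b] of the cube directions, which together
    span the space. *)
Lemma has_dim_reeve_prism m a b : 0 < m -> 0 < a -> 0 < b ->
  has_dim (reeve_prism m a b) (3 + n).
Proof.
move=> m0 a0 b0; exists 0, fullv; split; last by rewrite dimvf /dim /= mul1n.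
have ma0 : 0 < m * a by exact: mulr_gt0.
have mn0 : m != 0 by rewrite gt_eqF.
have an0 : a != 0 by rewrite gt_eqF.
apply/seteqP; split=> [v _|v _ A [aA PA]]; first by exists v; rewrite ?add0r //= memvf.
have A0 : A 0.
  apply: PA; rewrite /reeve_prism /= !linear0.
  by split; rewrite ?addr0 ?add0r ?mulr0 ?lexx ?(ltW ma0) // => j; rewrite mxE lexx ltW.
have AD u u' : A u -> A u' -> A (u + u').
  by move=> Au Au'; rewrite -[u]scale1r -[u']scale1r; exact: affine_set_add.
have AZ c u : A u -> A (c *: u).
  by move=> Au; rewrite -[_ *: _]addr0 -(scaler0 _ c); exact: affine_set_add.
have Apq (p q : bool) : A (prism_point (a *+ p) (a *+ q) ((m * a) *+ (p && q)) 0).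
  apply: PA; have :=
    prism_vertex_reeve_prism (p, q, [ffun=> false])
      (ltW m0) (ltW a0) (ltW b0).
  rewrite /prism_vertex; congr (reeve_prism _ _ _ (prism_point _ _ _ _)).
  by apply/rowP => j; rewrite !mxE ffunE.
have Aw j : A (prism_point 0 0 0 (b *: delta_mx 0 j)).
  apply: PA; have :=
    prism_vertex_reeve_prism (false, false, [ffun i => i == j])
      (ltW m0) (ltW a0) (ltW b0).
  rewrite /prism_vertex; congr (reeve_prism _ _ _ (prism_point _ _ _ _)).
  by apply/rowP => i; rewrite !mxE ffunE eqxx /= mulr_natr.
rewrite -[v]prism_point_coord.
set x := xcoord v; set y := ycoord v; set z := zcoord v; set w := wcoord v.
(* The tetrahedron coefficients are the barycentric coordinates again, without the one at the
   origin. *)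
have -> : prism_point x y z w =
    (z / (m * a)) *:
      prism_point (a *+ true) (a *+ true) ((m * a) *+ (true && true)) 0
  + ((m * x - z) / (m * a)) *:
      prism_point (a *+ true) (a *+ false) ((m * a) *+ (true && false)) 0
  + ((m * y - z) / (m * a)) *:
      prism_point (a *+ false) (a *+ true) ((m * a) *+ (false && true)) 0
  + \sum_j (w 0 j / b) *: prism_point 0 0 0 (b *: delta_mx 0 j).
  apply: coord_inj; rewrite !linearD linear_sum !linearZ /= !coord_prism_point.
  - rewrite big1 => [|j _]; last by rewrite linearZ /= coord_prism_point scaler0.
    by rewrite /GRing.scale /=; field; apply/andP.
  - rewrite big1 => [|j _]; last by rewrite linearZ /= coord_prism_point scaler0.
    by rewrite /GRing.scale /=; field; apply/andP.
  - rewrite big1 => [|j _]; last by rewrite linearZ /= coord_prism_point scaler0.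
    by rewrite /GRing.scale /=; field; apply/andP.
  - rewrite !scaler0 !add0r [LHS]row_sum_delta; apply: eq_bigr => j _.
    by rewrite linearZ /= coord_prism_point scalerA divfK // gt_eqF.
do 3 ?apply: (AD); try exact: AZ.
by apply: (big_ind A A0 AD) => j _; exact: AZ.
Qed.

(** The defining inequalities are homogeneous in the point, [a] and [b] jointly, whereas [m] is a
    slope and does not scale. *)
Lemma dilate_reeve_prism m a b (t : nat) : (0 < t)%N ->
  dilate t (reeve_prism m a b) = reeve_prism m (t%:R * a) (t%:R * b).
Proof.
move=> t_gt0; have t0 : 0 < t%:R :> R by rewrite ltr0n.
have le_t (c d : R) : (t%:R * c <= t%:R * d) = (c <= d) by rewrite ler_pM2l.
have main u : reeve_prism m (t%:R * a) (t%:R * b) (t%:R *: u) <-> reeve_prism m a b u.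
  rewrite /reeve_prism /= !linearZ /= /GRing.scale /=.
  have e1 c : m * (t%:R * c) = t%:R * (m * c) by ring.
  rewrite -mulrDr !e1 -mulrDr !le_t pmulr_rge0 //.
  split=> -[? ? ? ? wb]; split=> // j; have := wb j; rewrite !mxE.
    by rewrite pmulr_rge0 // le_t.
  by rewrite pmulr_rge0 // le_t.
apply/seteqP; split=> [_ [u Pu <-]|v Pv]; first exact/main.
have vE : v = t%:R *: (t%:R^-1 *: v) by rewrite scalerA mulfV ?scale1r // gt_eqF.
by exists (t%:R^-1 *: v); [apply/main; rewrite -vE|].
Qed.

End ReevePrism.

(** * Counting the lattice points of the prism *)

Section Counting.
Local Open Scope nat_scope.

Lemma card_ord_interval (N lo hi : nat) : lo <= hi <= N ->
  \sum_(z < N.+1) ((lo <= z) && (z <= hi)) = (hi - lo).+1.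
Proof.
move=> /andP[lohi hiN].
have -> j : \sum_(z < j) ((lo <= z) && (z <= hi)) = minn j hi.+1 - lo.
  elim: j => [|j IHj]; first by rewrite big_ord0; lia.
  by rewrite big_ord_recr /= IHj; lia.
lia.
Qed.

(** Induction on [r]: the new last term on the left is [x]; on the right, dropping the zero term
    [y = 0] and shifting [y] turns [y - r.+1] into [y - r], while the product grows by [x]. *)
Lemma sum_minn (x r : nat) :
  \sum_(y < (x + r).+1) minn x y = \sum_(y < (x + r).+1) (y - r) + x * r.
Proof.
elim: r => [|r IHr].
  rewrite muln0 !addn0; apply: eq_bigr => -[y /= yx] _; lia.
rewrite addnS big_ord_recr /= IHr [in RHS]big_ord_recl /= sub0n add0n.
rewrite (eq_bigr (fun y : 'I_(x + r).+1 => y - r)) => [|y _]; last by rewrite /bump; lia.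
by rewrite mulnS; lia.
Qed.

(* [x + y - T] is the truncated subtraction, i.e. [max(0, x + y - T)]. *)
Lemma sum_reeve_fiber (T x : nat) : x <= T ->
  \sum_(y < T.+1) (minn x y - (x + y - T)) = x * (T - x).
Proof.
move=> /subnKC <-; set r := T - x.
(* With [T = x + r] the subtracted term is [y - r]. It never exceeds [minn x y] for [y <= T], so
   adding it back cancels the truncated difference. *)
rewrite addKn; apply: (@addnI (\sum_(y < (x + r).+1) (y - r))).
rewrite -sum_minn -big_split /=; apply: eq_bigr => y _; have := ltn_ord y; lia.
Qed.

End Counting.

Lemma sum_reeve (F : numFieldType) (T : nat) :
  (\sum_(x < T.+1) x * (T - x))%N%:R = (T%:R ^+ 3 - T%:R) / 6 :> F.
Proof.
(* The partial sum is [T k (k - 1) / 2 - k (k - 1) (2 k - 1) / 6]; the bound on [k] ensures that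
   [T - x] is never truncated. *)
have aux k : (k <= T.+1)%N -> (\sum_(x < k) x * (T - x))%N%:R =
    k%:R * (k%:R - 1) * (3 * T%:R - (2 * k%:R - 1)) / 6 :> F.
  elim: k => [_|k IHk kT]; first by rewrite big_ord0 !mul0r.
  by rewrite big_ord_recr natrD IHk 1?ltnW // natrM natrB // -natr1 /=; field.
by rewrite aux // -natr1; field.
Qed.

Definition reeve_index (m T B n : nat) :=
  ('I_T.+1 * 'I_T.+1 * 'I_(m * T).+1 * {ffun 'I_n -> 'I_B.+1})%type.

(** Truncated subtraction merges the facets [0 <= z] and [m (x + y - T) <= z] into one lower
    bound. *)
Definition reeve_points m T B n : {set reeve_index m T B n} :=
  [set t : reeve_index m T B n |
    let: (x, y, z, _) := t in (m * (x + y - T) <= z)%N && (z <= m * minn x y)%N].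

(** The cube coordinates split off as [B.+1 ^ n]. Each fibre over [(x, y)] has its length plus one
    points: the lengths add up by [sum_reeve_fiber], and the ones give [T.+1 ^ 2]. *)
Lemma card_reeve_points m T B n :
  #|reeve_points m T B n| =
  ((m * (\sum_(x < T.+1) x * (T - x)) + T.+1 ^ 2) * B.+1 ^ n)%N.
Proof.
rewrite -sum1_card big_mkcond /=.
transitivity (\sum_(t : reeve_index m T B n)
   ((m * (t.1.1.1 + t.1.1.2 - T) <= t.1.2) && (t.1.2 <= m * minn t.1.1.1 t.1.1.2)))%N.
  by apply: eq_bigr => -[[[x y] z] g] _; rewrite inE /=; case: ifP.
rewrite -(pair_bigA _ (fun (p : 'I_T.+1 * 'I_T.+1 * 'I_(m * T).+1)
    (g : {ffun 'I_n -> 'I_B.+1}) =>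
  ((m * (p.1.1 + p.1.2 - T) <= p.2) && (p.2 <= m * minn p.1.1 p.1.2))%N : nat)) /=.
under eq_bigr => p _ do rewrite sum_nat_const card_ffun !card_ord mulnC.
rewrite -big_distrl /=; congr (_ * _)%N.
rewrite -(pair_bigA _ (fun (p : 'I_T.+1 * 'I_T.+1) (z : 'I_(m * T).+1) =>
  ((m * (p.1 + p.2 - T) <= z) && (z <= m * minn p.1 p.2))%N : nat)) /=.
rewrite -(pair_bigA _ (fun (x y : 'I_T.+1) => \sum_(z < (m * T).+1)
  ((m * (x + y - T) <= z) && (z <= m * minn x y)))%N) /=.
transitivity (\sum_(x < T.+1) (m * (x * (T - x)) + T.+1))%N; last first.
  by rewrite big_split /= -big_distrr sum_nat_const card_ord /= mulnn.
apply: eq_bigr => x _; rewrite -sum_reeve_fiber -1?ltnS // big_distrr /=.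
transitivity (\sum_(y < T.+1) (m * (minn x y - (x + y - T)) + 1))%N; last first.
  by rewrite big_split /= sum_nat_const card_ord muln1.
apply: eq_bigr => y _; have xT := ltn_ord x; have yT := ltn_ord y.
rewrite card_ord_interval -?mulnBr ?addn1 //.
by rewrite !leq_mul2l; apply/andP; split; apply/orP; right; lia.
Qed.

(** * The Ehrhart polynomial of the prism *)

Section Ehrhart.
Context {R : realType} {n : nat}.

Definition reeve_lattice_point m T B (t : reeve_index m T B n) : 'rV[R]_(3 + n) :=
  let: (x, y, z, g) := t in
  prism_point (x : nat)%:R (y : nat)%:R (z : nat)%:R (\row_j (g j : nat)%:R).

Lemma reeve_lattice_point_inj m T B : injective (@reeve_lattice_point m T B).
Proof.
move=> [[[x y] z] g] [[[x' y'] z'] g'] /= e.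
have eqN (j k : nat) : j%:R = k%:R :> R -> j = k by move/eqP; rewrite eqr_nat => /eqP.
have := congr1 xcoord e; rewrite !coord_prism_point => /eqN/val_inj ->.
have := congr1 ycoord e; rewrite !coord_prism_point => /eqN/val_inj ->.
have := congr1 zcoord e; rewrite !coord_prism_point => /eqN/val_inj ->.
have := congr1 wcoord e; rewrite !coord_prism_point => /rowP eg.
by congr (_, _); apply/ffunP => j; have := eg j; rewrite !mxE => /eqN/val_inj.
Qed.

Lemma lattice_reeve_prism (m T B : nat) : (0 < m)%N ->
  reeve_prism m%:R T%:R B%:R `&` lattice =
  [set` [fset reeve_lattice_point t | t in reeve_points m T B n]%fset] :> set 'rV[R]_(3 + n).
Proof.
move=> m0; apply/seteqP; split=> v /=.
- move=> [[z0 zx zy xyz wB] vint].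
  have mR0 : 0 < m%:R :> R by rewrite ltr0n.
  have x0 : 0 <= xcoord v by rewrite -(pmulr_rge0 _ mR0); exact: le_trans zx.
  have y0 : 0 <= ycoord v by rewrite -(pmulr_rge0 _ mR0); exact: le_trans zy.
  have natc i : 0 <= v 0 i -> exists k : nat, v 0 i = k%:R.
    by move=> v0; apply/natrP; rewrite natrEint v0 andbT; exact: vint.
  have [x xE] := natc _ x0; have [y yE] := natc _ y0; have [z zE] := natc _ z0.
  rewrite -/(xcoord v) in xE; rewrite -/(ycoord v) in yE; rewrite -/(zcoord v) in zE.
  have /(_ _)/cid w j : exists k : nat, wcoord v 0 j = k%:R.
    by have /andP[] := wB j; rewrite !mxE => /natc.
  move: zx zy xyz; rewrite xE yE zE -!natrD -!natrM -!natrD !ler_nat => zx zy xyz.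
  (* Combining [m (x + y) <= z + m T] with [z <= m y] gives [m x <= m T]; the bound on [y] is
     symmetric. *)
  have xT : (x < T.+1)%N by rewrite ltnS -(leq_pmul2l m0); lia.
  have yT : (y < T.+1)%N by rewrite ltnS -(leq_pmul2l m0); lia.
  have zT : (z < (m * T).+1)%N by rewrite ltnS (leq_trans zx) // leq_mul2l -ltnS xT orbT.
  have wT j : (sval (w j) < B.+1)%N.
    by rewrite ltnS -(ler_nat R) -(svalP (w j)); have /andP[] := wB j.
  apply/imfsetP; exists (Ordinal xT, Ordinal yT, Ordinal zT, [ffun j => Ordinal (wT j)]).
    rewrite inE /= mulnBr; apply/andP; split; first lia.
    by case: (leqP x y).
  apply: coord_inj; rewrite /= !coord_prism_point //; apply/rowP => j.
  by rewrite [RHS]mxE ffunE; exact: svalP (w j).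
- move=> /imfsetP[[[[x y] z] g]] /=; rewrite inE /= => /andP[lo hi] ->.
  have xT := ltn_ord x; have yT := ltn_ord y.
  split; last first.
    move=> i; rewrite mxE; case: (fintype.split i) => [k|k]; rewrite mxE; last exact: intr_nat.
    by case: k => -[|[|[|//]]] ? /=; exact: intr_nat.
  rewrite /reeve_prism /= !coord_prism_point; split.
  + exact: ler0n.
  + by rewrite -natrM ler_nat (leq_trans hi) // leq_mul2l geq_minl orbT.
  + by rewrite -natrM ler_nat (leq_trans hi) // leq_mul2l geq_minr orbT.
  + by rewrite -natrD -!natrM -natrD ler_nat; move: lo; rewrite mulnBr; lia.
  + by move=> j; rewrite mxE ler0n ler_nat -ltnS ltn_ord.
Qed.

Definition reeve_prism_ehrhart (m a b : nat) : {poly R} :=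
  (b%:R *: 'X + 1) ^+ n *
  ((m%:R / 6) *: (a%:R ^+ 3 *: 'X^3 - a%:R *: 'X) + (a%:R *: 'X + 1) ^+ 2).

Lemma ehrhart_reeve_prism (m a b : nat) : (0 < m)%N ->
  ehrhart_polynomial (reeve_prism m%:R a%:R b%:R : set 'rV[R]_(3 + n))
    (reeve_prism_ehrhart m a b).
Proof.
move=> m0 t t0; rewrite /ehrhart dilate_reeve_prism // -!natrM lattice_reeve_prism //.
rewrite set_fsetK card_imfset; last exact: reeve_lattice_point_inj.
rewrite -[size _]/(size (enum (reeve_points m (t * a) (t * b) n))) -cardE card_reeve_points.
rewrite natrM natrX natrD natrM sum_reeve natrX -(@natr1 _ (t * a)%N) -(@natr1 _ (t * b)%N) !natrM.
rewrite /reeve_prism_ehrhart !(hornerM, horner_exp, hornerD, hornerN,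
  hornerZ, hornerX, hornerC).
rewrite mulrC; congr (_ * _ ^+ _); last by rewrite mulrC.
by field.
Qed.

End Ehrhart.

(** * Comparison of the coefficients of the Ehrhart polynomial *)

Section Coefficients.
Local Open Scope nat_scope.

Definition linear_pow_coef n l k := 'C(n, k) * l ^ k.

(** The ratio of coefficients two degrees apart, cleared of denominators: two applications of
    [(k + 1) C(n, k + 1) = (n - k) C(n, k)]. *)
Lemma linear_pow_coef_step2 n l k :
  k.+1 * k.+2 * linear_pow_coef n l k.+2 =
  (n - k) * (n - k.+1) * l ^ 2 * linear_pow_coef n l k.
Proof.
rewrite /linear_pow_coef; have e1 := mul_bin_left n k; have e2 := mul_bin_left n k.+1.
rewrite -addn2 expnD.
transitivity (k.+1 * (k.+2 * 'C(n, k.+2)) * (l ^ k * l ^ 2)); first by rewrite addn2; ring.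
rewrite e2 (_ : k.+1 * _ = (n - k.+1) * (k.+1 * 'C(n, k.+1))); last by ring.
by rewrite e1; ring.
Qed.

(** The left side is one term of the binomial expansion of [(1 + l) ^ n]. The bound is uniform in
    [k], and the parameter [m] is chosen from it. *)
Lemma linear_pow_coef_le n l k : linear_pow_coef n l k <= l.+1 ^ n.
Proof.
have [kn|nk] := leqP k n; last by rewrite /linear_pow_coef bin_small.
rewrite -add1n expnDn (bigD1 (Ordinal (kn : k < n.+1))) //= exp1n mul1n.
exact: leq_addr.
Qed.

Lemma linear_pow_coef_gt0 n l k : 0 < l -> k <= n -> 0 < linear_pow_coef n l k.
Proof. by move=> l0 kn; rewrite muln_gt0 bin_gt0 kn expn_gt0 l0. Qed.

Lemma linear_pow_coef_lt n k : 5 <= n -> k + 5 <= n ->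
  16 * linear_pow_coef n (n - 3) k < linear_pow_coef n (n - 3) k.+2.
Proof.
move=> n5 kn; have q0 : 0 < linear_pow_coef n (n - 3) k by apply: linear_pow_coef_gt0; lia.
have k0 : 0 < k.+1 * k.+2 by [].
rewrite -(ltn_pmul2l k0) linear_pow_coef_step2 mulnA ltn_pmul2r //.
(* From [k <= n - 5], the right side is at least [20 (k + 2)^2], which exceeds
   [16 (k + 1) (k + 2)]. *)
have h1 : 5 * 4 <= (n - k) * (n - k.+1) by apply: leq_mul; lia.
have h2 : k.+2 * k.+2 <= (n - 3) ^ 2 by rewrite -mulnn; apply: leq_mul; lia.
by apply: leq_trans (leq_mul h1 h2); lia.
Qed.

Lemma linear_pow_coef_gt n k : 5 <= n -> n - 4 <= k <= n - 2 ->
  linear_pow_coef n (n - 3) k.+2 < 16 * linear_pow_coef n (n - 3) k.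
Proof.
move=> n5 kn; have q0 : 0 < linear_pow_coef n (n - 3) k by apply: linear_pow_coef_gt0; lia.
have k0 : 0 < k.+1 * k.+2 by [].
rewrite -(ltn_pmul2l k0) linear_pow_coef_step2 mulnA ltn_pmul2r //.
(* From [k >= n - 4], the left side is at most [12 (k + 1)^2], which is below
   [16 (k + 1) (k + 2)]. *)
have h1 : (n - k) * (n - k.+1) <= 4 * 3 by apply: leq_mul; lia.
have h2 : (n - 3) ^ 2 <= k.+1 * k.+1 by rewrite -mulnn; apply: leq_mul; lia.
by apply: leq_ltn_trans (leq_mul h1 h2) _; lia.
Qed.

End Coefficients.

Lemma coef_linear_pow (F : comNzRingType) n l k :
  ((l%:R *: 'X + 1 : {poly F}) ^+ n)`_k = (linear_pow_coef n l k)%:R.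
Proof.
rewrite addrC exprDn (eq_bigr (fun i : 'I_n.+1 => (linear_pow_coef n l i)%:R *: 'X^i)).
  rewrite -(poly_def n.+1 (fun i => (linear_pow_coef n l i)%:R)) coef_poly.
  by case: ltnP => // nk; rewrite /linear_pow_coef bin_small.
move=> i _; rewrite expr1n mul1r exprZn -natrX -scaler_nat scalerA -natrM.
by [].
Qed.

(** For [a = 4] the cubic part is [m (2/3) (16 X^3 - X)]. Multiplication by a power of [X] shifts
    coefficients, and the conditionals supply the zeros below the shift. *)
Lemma coef_reeve_prism_ehrhart (R : realType) n m l j :
  (reeve_prism_ehrhart (R := R) (n := n) m 4 l)`_j =
  m%:R * (2 / 3) * (16 * (if (j < 3)%N then 0 else (linear_pow_coef n l (j - 3))%:R)
     - (if (j < 1)%N then 0 else (linear_pow_coef n l (j - 1))%:R))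
  + (16 * (if (j < 2)%N then 0 else (linear_pow_coef n l (j - 2))%:R)
     + 8 * (if (j < 1)%N then 0 else (linear_pow_coef n l (j - 1))%:R)
     + (linear_pow_coef n l j)%:R).
Proof.
rewrite /reeve_prism_ehrhart -!coef_linear_pow; set q := _ ^+ n.
have -> : q * (m%:R / 6 *: (4 ^+ 3 *: 'X^3 - 4 *: 'X) + (4 *: 'X + 1) ^+ 2) =
  m%:R * (2 / 3) *: (16 *: (q * 'X^3) - q * 'X^1) +
    (16 *: (q * 'X^2) + 8 *: (q * 'X^1) + q).
  rewrite (_ : m%:R * (2 / 3) = 4 * (m%:R / 6)); last by field.
  by rewrite -!mul_polyC rmorphXn /= !polyCM !polyC_natr; ring.
by rewrite !coefD !coefZ coefB !coefZ !coefMXn.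
Qed.

(** The first summand is at most [-40 b], and the others total at most [(16 + 8 + 1) b = 25 b]. *)
Lemma dominant_term_lt0 (F : realFieldType) (b q0 q1 q2 q3 : F) :
  0 < b -> q0 <= b -> q1 <= b -> q2 <= b -> 16 * q3 + 1 <= q1 ->
  60 * b * (2 / 3) * (16 * q3 - q1) + (16 * q2 + 8 * q1 + q0) < 0.
Proof.
move=> b0 q0b q1b q2b gap.
have : b * (16 * q3 - q1) <= b * -1 by rewrite ler_pM2l //; lra.
by lra.
Qed.

Theorem theorem3p4 (R : realType) (d : nat) (hd : (12 <= d)%N) :
  exists (N : nat) (P : set 'rV[R]_N) (p : {poly R}),
    [/\ integral_polytope P,
        has_dim P d,
        ehrhart_polynomial P p,
        [/\ 0 < p`_(d - 2), 0 < p`_(d - 3) & 0 < p`_(d - 4)] &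
        forall j : nat, (1 <= j)%N -> (j < d - 4)%N -> p`_j < 0].
Proof.
(* [B] bounds every coefficient of [(l X + 1) ^ n], and [m = 60 B] is the multiple for which
   [dominant_term_lt0] applies. *)
have [n [n9 ->]] : exists n, (9 <= n)%N /\ d = (3 + n)%N by exists (d - 3)%N; lia.
pose l := (n - 3)%N; pose B := (l.+1 ^ n)%N; pose m := (60 * B)%N.
have l0 : (0 < l)%N by rewrite /l; lia.
have B0 : (0 < B)%N by rewrite expn_gt0.
have m0 : (0 < m)%N by rewrite muln_gt0.
exists (3 + n)%N, (reeve_prism m%:R 4 l%:R), (reeve_prism_ehrhart (n := n) m 4 l).
(* Since [d = n + 3], these [k] correspond to the degrees [d - 4], [d - 3] and [d - 2]. The terms
   free of [m] are nonnegative, so a positive bracket suffices. *)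
have pos k : (n - 4 <= k <= n - 2)%N -> 0 < (reeve_prism_ehrhart (R := R) (n := n) m 4 l)`_(k + 3).
  move=> kn; rewrite coef_reeve_prism_ehrhart.
  rewrite !ifF; try lia.
  rewrite addnK (_ : k + 3 - 1 = k.+2)%N; last lia.
  apply: ltr_wpDr; first by rewrite !addr_ge0 ?mulr_ge0 ?ler0n.
  apply: mulr_gt0; first by rewrite mulr_gt0 ?ltr0n //; lra.
  by rewrite subr_gt0 -natrM ltr_nat linear_pow_coef_gt //; lia.
split.
- exact: (@integral_polytope_reeve_prism R n m 4 l).
- by apply: has_dim_reeve_prism; rewrite ltr0n.
- exact: (@ehrhart_reeve_prism R n m 4 l).
- have -> : (3 + n - 2 = n - 2 + 3)%N by lia.
  have -> : (3 + n - 3 = n - 3 + 3)%N by lia.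
  have -> : (3 + n - 4 = n - 4 + 3)%N by lia.
  by split; apply: (pos); lia.
move=> j j1 jn; rewrite coef_reeve_prism_ehrhart.
(* For [j = 1, 2] the term from [X^3] is absent and the other one is positive; for [j >= 3],
   [j < d - 4] means [j - 3 <= n - 5]. *)
have gap : (16 * (if (j < 3)%N then 0 else linear_pow_coef n l (j - 3)) <
            linear_pow_coef n l (j - 1))%N.
  case: (ltnP j 3) => j3; first by rewrite muln0 linear_pow_coef_gt0 //; lia.
  rewrite (_ : j - 1 = (j - 3).+2)%N; last lia.
  by apply: (@linear_pow_coef_lt n (j - 3)); lia.
have coef_le k : (linear_pow_coef n l k)%:R <= B%:R :> R.
  by rewrite ler_nat linear_pow_coef_le.
have BR0 : 0 < B%:R :> R by rewrite ltr0n.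
have [qj q1] := (coef_le j, coef_le (j - 1)%N).
have q2 : (if (j < 2)%N then 0 else (linear_pow_coef n l (j - 2))%:R) <= B%:R :> R.
  by case: ifP => // _; exact: ltW.
(* Strict inequality between naturals leaves a gap of at least 1, which the factor [m] amplifies. *)
have {}gap : 16 * (if (j < 3)%N then 0 else (linear_pow_coef n l (j - 3))%:R) + 1 <=
    (linear_pow_coef n l (j - 1))%:R :> R.
  move: gap; rewrite -(ler_nat R) -natr1 natrM; case: ifP => //.
have -> : (j < 1)%N = false by lia.
rewrite [m%:R]natrM.
exact: dominant_term_lt0 BR0 qj q1 q2 gap.
Qed.
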